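(* Let $\phi:\mathbb{R}^N\to\mathbb{R}$ be a proper, lower semicontinuous, $\rho$-weakly convex function, and let $\lambda>0$ be such that $\lambda^{-1}-\rho>0$. Let $g_f$ be an $\epsilon$-type (f) approximation of $\mathrm{prox}_{\lambda\phi}$ with parameter $\lambda$. Then $$\sup_{x\in\mathbb{R}^N}\|\mathrm{prox}_{\lambda\phi}(x)-g_f(x)\|\le\sqrt{N(\lambda^{-1}-\rho)^{-1}\epsilon} .$$
   Context: $\phi$ is $\rho$-weakly convex if $\phi+\frac{\rho}{2}\|\cdot\|^2$ is convex. $\mathrm{prox}_{\lambda\phi}(y)=\operatorname{argmin}_{x\in\mathbb{R}^N}\{\phi(x)+\frac{1}{2\lambda}\|x-y\|^2\}$. For $\epsilon>0$, an $\epsilon$-type (f) approximation with parameter $\lambda$ is the map $g_f(y)=y-\lambda\nabla_x u^\epsilon(y,\lambda)$, where $u^\epsilon$ is the approximation of the Moreau envelope $u(y,\lambda)=\inf_x\{\phi(x)+\frac1{2\lambda}\|x-y\|^2\}$ obtained as the solution of the viscous Hamilton–Jacobi equation $$\frac{\partial}{\partial\lambda}u^\epsilon+\frac12\|\nabla_x u^\epsilon\|^2=\frac{\epsilon}{2}\Delta_x u^\epsilon\ \text{ in }\mathbb{R}^N\times(0,\Lambda],\qquad u^\epsilon(x,0)=\phi(x)\ \text{ on }\mathbb{R}^N\times\{0\},$$ with $\lambda\in(0,\Lambda]$. This solution is the one given by the Cole–Hopf formula $$u^\epsilon(x,\lambda)=-\epsilon\log\left(\frac{1}{(2\pi\epsilon\lambda)^{N/2}}\int_{\mathbb{R}^N}\exp\left(-\frac{\phi(y)}{\epsilon}-\frac{\|x-y\|^2}{2\epsilon\lambda}\right)dy\right),$$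 so that $$g_f(x)=\frac{\mathbb{E}_{y\sim\mathcal{N}(x,\epsilon\lambda\,\mathrm{Id})}[y\,e^{-\phi(y)/\epsilon}]}{\mathbb{E}_{y\sim\mathcal{N}(x,\epsilon\lambda\,\mathrm{Id})}[e^{-\phi(y)/\epsilon}]}.$$ *)

(* Defs.v *)
From HB Require Import structures.
From mathcomp Require Import all_boot all_order all_algebra.
From mathcomp Require Import all_classical all_reals all_analysis.
Set Implicit Arguments.
Unset Strict Implicit.
Unset Printing Implicit Defensive.
Import Order.TTheory GRing.Theory Num.Theory.
Import numFieldNormedType.Exports.
Local Open Scope classical_set_scope.
Local Open Scope ring_scope.

(** R^N is 'rV[R]_N.  The library norm `|x| on 'rV[R]_N is the sup norm, hence
    the separate Euclidean norm. *)
Definition enorm (R : realType) (N : nat) (x : 'rV[R]_N) : R :=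
  Num.sqrt (\sum_(i < N) x 0 i ^+ 2).

Definition proper_function (T : Type) (R : realType) (f : T -> \bar R) : Prop :=
  (exists x, f x < +oo)%E /\ (forall x, -oo < f x)%E.

Definition weakly_convex (R : realType) (N : nat) (rho : R)
    (phi : 'rV[R]_N -> R) : Prop :=
  convex_function [set: 'rV[R]_N]
    (fun x => phi x + rho / 2 * enorm x ^+ 2).

Definition argmin (T : Type) (R : realType) (f : T -> R) : set T :=
  [set x | forall z, f x <= f z].

(** A point of the argmin, and 0 when the argmin is empty. *)
Definition prox (R : realType) (N : nat) (lambda : R) (phi : 'rV[R]_N -> R)
    (y : 'rV[R]_N) : 'rV[R]_N :=
  xget 0 (argmin (fun x => phi x + (2 * lambda)^-1 * enorm (x - y) ^+ 2)).

(** The library has no Lebesgue measure on R^N.  It is built here on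
    N.-tuple R, whose sigma-algebra (generated by the coordinates) is the Borel
    one, by lambda^(N+1) := image of lambda (x) lambda^N under
    (a, t) |-> a :: t, starting from the unit mass on the only 0-tuple. *)
Section lebesgue_tuple_step.
Context {R : realType} {n : nat}.
Notation TR := (measurableTypeR R).
Variable mu : {sigma_finite_measure set (n.-tuple TR) -> \bar R}.

Definition tuple_cons (p : TR * n.-tuple TR) : n.+1.-tuple TR :=
  [tuple of p.1 :: p.2].

Lemma measurable_tuple_cons : measurable_fun setT tuple_cons.
Proof.
apply: (@measurable_cons _ _ (TR * n.-tuple TR)%type TR fst n snd).
  exact: measurable_fst.
exact: measurable_snd.
Qed.

Definition lebesgue_cons : set (n.+1.-tuple TR) -> \bar R :=
  pushforward (@lebesgue_measure R \x mu)%E tuple_cons.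

Let lebesgue_cons0 : lebesgue_cons set0 = 0%E.
Proof. by rewrite /lebesgue_cons /pushforward preimage_set0 measure0. Qed.

Let lebesgue_cons_ge0 A : (0 <= lebesgue_cons A)%E.
Proof. by apply: integral_ge0 => x _; exact: measure_ge0. Qed.

Let lebesgue_cons_sigma_additive : semi_sigma_additive lebesgue_cons.
Proof.
move=> F mF tF mUF; rewrite /lebesgue_cons /pushforward preimage_bigcup.
have mcons A : measurable A -> measurable (tuple_cons @^-1` A).
  by move=> mA; rewrite -[X in measurable X]setTI; exact: measurable_tuple_cons.
apply: measure_semi_sigma_additive.
- by move=> k; exact: mcons.
- apply/trivIsetP => /= i j _ _ ij; rewrite -preimage_setI.
  by move/trivIsetP : tF => /(_ _ _ _ _ ij) ->//; rewrite preimage_set0.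
- by rewrite -preimage_bigcup; exact: mcons.
Qed.

HB.instance Definition _ := isMeasure.Build _ _ _ lebesgue_cons
  lebesgue_cons0 lebesgue_cons_ge0 lebesgue_cons_sigma_additive.

Let lebesgue_cons_sigma_finite : sigma_finite setT lebesgue_cons.
Proof.
have /sigma_finiteP[F [TF ndF Foo]] := sigma_finiteT (@lebesgue_measure R).
have /sigma_finiteP[G [TG ndG Goo]] := sigma_finiteT mu.
pose split_tuple (t : n.+1.-tuple TR) : TR * n.-tuple TR :=
  (thead t, [tuple of behead t]).
have sK : cancel tuple_cons split_tuple.
  by move=> [a t]; rewrite /split_tuple theadE; congr (_, _); exact: val_inj.
have ms : measurable_fun setT split_tuple.
  apply/measurable_fun_pairP; split; last exact: measurable_behead.
  exact: measurable_tnth.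
exists (fun k => split_tuple @^-1` (F k `*` G k)).
  apply/seteqP; split=> // t _.
  have [i _ Fi] : (\bigcup_k F k) (split_tuple t).1 by rewrite -TF.
  have [j _ Gj] : (\bigcup_k G k) (split_tuple t).2 by rewrite -TG.
  exists (maxn i j) => //; split => /=.
  - by move: Fi; exact/subsetPset/ndF/leq_maxl.
  - by move: Gj; exact/subsetPset/ndG/leq_maxr.
move=> k; have [mF Fk] := Foo k; have [mG Gk] := Goo k; split.
  by rewrite -[X in measurable X]setTI; apply: ms => //; exact: measurableX.
rewrite /lebesgue_cons /pushforward -comp_preimage.
rewrite (_ : split_tuple \o tuple_cons = id); last exact/funext.
by rewrite preimage_id product_measure1E// lte_mul_pinfty// ge0_fin_numE.
Qed.

HB.instance Definition _ := Measure_isSigmaFinite.Build _ _ _ lebesgue_cons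
  lebesgue_cons_sigma_finite.

End lebesgue_tuple_step.

Fixpoint lebesgue_tuple (R : realType) (N : nat) :
    {sigma_finite_measure set (N.-tuple (measurableTypeR R)) -> \bar R} :=
  match N with
  | 0 => \d_([tuple] : 0.-tuple (measurableTypeR R))
  | n.+1 => lebesgue_cons (lebesgue_tuple R n)
  end.

Definition row_of_tuple (R : realType) (N : nat)
    (t : N.-tuple (measurableTypeR R)) : 'rV[R]_N :=
  \row_i tnth t i.

(** The solution u^eps(x, lambda), lambda > 0, of the viscous Hamilton-Jacobi
    equation d_lambda u + |grad u|^2 / 2 = (eps / 2) Delta u, u(., 0) = phi,
    that the Cole-Hopf transform v = exp (- u / eps) turns into the heat flow
    v(., lambda) = N(0, eps lambda Id) * exp (- phi / eps). *)
Definition cole_hopf (R : realType) (N : nat) (eps : R) (phi : 'rV[R]_N -> R)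
    (x : 'rV[R]_N) (lambda : R) : R :=
  - eps * ln (((2 * pi * eps * lambda) `^ (N%:R / 2))^-1 *
    \int[lebesgue_tuple R N]_t
      expR (- phi (row_of_tuple t) / eps
            - enorm (x - row_of_tuple t) ^+ 2 / (2 * eps * lambda))).

Definition gradient (R : realType) (N : nat) (f : 'rV[R]_N -> R)
    (x : 'rV[R]_N) : 'rV[R]_N :=
  \row_i 'D_(delta_mx 0 i) f x.

Definition typef_approx (R : realType) (N : nat) (eps lambda : R)
    (phi : 'rV[R]_N -> R) (y : 'rV[R]_N) : 'rV[R]_N :=
  y - lambda *: gradient (fun x => cole_hopf eps phi x lambda) y.

(* Main.v *)
Require Import Defs.
From mathcomp Require Import all_boot all_order all_algebra.
From mathcomp Require Import all_classical all_reals all_analysis.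
From mathcomp Require Import measurable_realfun ring lra.
Set Implicit Arguments.
Unset Strict Implicit.
Unset Printing Implicit Defensive.
Import Order.TTheory GRing.Theory Num.Theory.
Import numFieldNormedType.Exports.
Local Open Scope classical_set_scope.
Local Open Scope ring_scope.

(** Fix x and put V z := phi z + |z - x|^2 / (2 lambda), m := lambda^-1 - rho.
    Adding the quadratic term turns rho-weak convexity of phi into m-strong
    convexity of V [strongly_convex_prox_objective], so V has a minimiser p,
    which is the proximal point [strongly_convex_min].

    Up to a factor that depends on N, lambda and eps only, the Cole-Hopf integral
    at x is Z := int w, where w := exp (- V / eps).  Differentiating its
    logarithm along a coordinate axis shows that g_f (x) is the mean of the
    probability density w / Z [typef_approxE].  The squared distance from p to
    that mean is at most the mean of the squared distance to p
    [gibbs_mean_sqr], so everything reduces to the moment bound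
    [gibbs_second_moment]
<<
      (m / eps) * int w(z) |z - p|^2 dz <= N * Z.
>>
    If V were differentiable, this would be integration by parts against the
    field z - p: N Z is the integral of (w / eps) * <grad V (z), z - p>, and
    strong convexity gives <grad V (z), z - p> >= m |z - p|^2.  As V need not
    be differentiable, w is compared with its dilations about p instead.
    The change of variables z |-> p + s (z - p), 0 < s < 1, gives
<<
      s^-N * Z = int w(p + s (z - p)) dz,
>>
    while strong convexity along the ray from p through z gives
<<
      V(p + s (z - p)) + (1 - s^2) * (m / 2) * |z - p|^2 <= V z,
>>
    hence w(p + s (z - p)) >= w(z) * (1 + (1 - s^2) * m / (2 eps) * |z - p|^2)
    since exp y >= 1 + y.  Integrating yields
<<
      (s^-N - 1) * Z >= (1 - s^2) * m / (2 eps) * int w(z) |z - p|^2 dz,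
>>
    and the moment bound is what remains after dividing by 1 - s and letting s
    tend to 1.

    The measure theory behind this is: lower semicontinuous functions of a
    row vector are measurable for the product sigma-algebra on tuples
    [measurable_lsc_row_of_tuple], integrals over tuples are computed one
    coordinate at a time [ge0_integral_lebesgue_tupleS], and w decays like a
    Gaussian, so that it may be multiplied by anything of exponential growth
    [integrable_gibbsM]. *)

(** * Euclidean norm and strong convexity *)

Lemma sqr_enorm (R : realType) (N : nat) (x : 'rV[R]_N) :
  enorm x ^+ 2 = \sum_(i < N) x 0 i ^+ 2.
Proof. by rewrite sqr_sqrtr// sumr_ge0// => i _; exact: sqr_ge0. Qed.

Lemma enorm_ge0 (R : realType) (N : nat) (x : 'rV[R]_N) : 0 <= enorm x.
Proof. exact: sqrtr_ge0. Qed.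

Lemma le_coord_enorm (R : realType) (N : nat) (x : 'rV[R]_N) (i : 'I_N) :
  `|x 0 i| <= enorm x.
Proof.
rewrite -(@ler_pXn2r _ 2)// ?nnegrE ?enorm_ge0// real_normK ?num_real//.
rewrite sqr_enorm (bigD1 i)//= lerDl sumr_ge0// => j _; exact: sqr_ge0.
Qed.

Lemma le_norm_enorm (R : realType) (N : nat) (x : 'rV[R]_N) : `|x| <= enorm x.
Proof.
rewrite (_ : `|x| = mx_norm x)// mx_normrE.
apply: bigmax_le => [|[i j] _ /=]; first exact: enorm_ge0.
by rewrite ord1 le_coord_enorm.
Qed.

(** The parallelogram identity in barycentric form: it makes the defect of
    convexity of the squared norm exact, so that quadratic terms can be traded
    between weak and strong convexity. *)
Lemma sqr_enorm_convex (R : realType) (N : nat) (t : R) (a b x : 'rV[R]_N) :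
  enorm (t *: a + (1 - t) *: b - x) ^+ 2 =
  t * enorm (a - x) ^+ 2 + (1 - t) * enorm (b - x) ^+ 2
  - t * (1 - t) * enorm (a - b) ^+ 2.
Proof.
rewrite !sqr_enorm !mulr_sumr -sumrN -!big_split/=; apply: eq_bigr => i _.
by rewrite !mxE; ring.
Qed.

Definition strongly_convex (R : realType) (N : nat) (m : R)
    (V : 'rV[R]_N -> R) : Prop :=
  forall (t : R) (a b : 'rV[R]_N), 0 <= t <= 1 ->
    V (t *: a + (1 - t) *: b) <=
    t * V a + (1 - t) * V b - m / 2 * (t * (1 - t)) * enorm (a - b) ^+ 2.

Definition prox_objective (R : realType) (N : nat) (lambda : R)
    (phi : 'rV[R]_N -> R) (x z : 'rV[R]_N) : R :=
  phi z + (2 * lambda)^-1 * enorm (z - x) ^+ 2.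

Lemma strongly_convex_prox_objective (R : realType) (N : nat) (rho lambda : R)
    (phi : 'rV[R]_N -> R) (x : 'rV[R]_N) :
  weakly_convex rho phi ->
  strongly_convex (lambda^-1 - rho) (prox_objective lambda phi x).
Proof.
move=> wc t a b t01; rewrite /prox_objective.
have /andP[t0 t1] := t01.
have := wc (Itv01 t0 t1) a b; rewrite !inE => /(_ I I).
move=> wct.
have {}wct : phi (t *: a + (1 - t) *: b)
      + rho / 2 * enorm (t *: a + (1 - t) *: b) ^+ 2 <=
    t * (phi a + rho / 2 * enorm a ^+ 2)
    + (1 - t) * (phi b + rho / 2 * enorm b ^+ 2) by exact: wct.
have := sqr_enorm_convex t a b x; have := sqr_enorm_convex t a b 0.
rewrite !subr0 => n0 nx.
have e : phi (t *: a + (1 - t) *: b) <=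
   t * phi a + (1 - t) * phi b + rho / 2 * (t * (1 - t) * enorm (a - b) ^+ 2).
  by move: wct; rewrite n0; lra.
rewrite nx (_ : (2 * lambda)^-1 = lambda^-1 / 2); first by lra.
by rewrite invfM mulrC.
Qed.

(** * Existence of the proximal point *)

(** If f had no minimum on K, every point of K would lie in one of the open
    sets {x | f y < f x} with y in K.  Finitely many of them cover K, but the
    lowest of these finitely many y is in none of them. *)
Lemma lower_semicontinuous_min (R : realType) (X : ptopologicalType)
    (K : set X) (f : X -> R) :
  K !=set0 -> compact K -> (forall a, open [set x | a < f x]) ->
  exists2 p, K p & forall z, K z -> f p <= f z.
Proof.
move=> [k0 Kk0] + lscf; rewrite compact_cover => cK.
apply: contrapT => nomin.
have below z : K z -> exists2 y, K y & f y < f z.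
  move=> Kz; apply: contrapT => noy; apply: nomin; exists z => // y Ky.
  by rewrite leNgt; apply/negP => fyz; apply: noy; exists y.
have [D' D'K Kcover] : finite_subset_cover K (fun y => [set x | f y < f x]) K.
  by apply: cK => [y _|z /below[y Ky fyz]]; [exact: lscf|exists y].
have [y0 D'y0 _] := Kcover _ Kk0.
have seqmin (s : seq X) : s != [::] ->
    exists2 p, p \in s & forall z, z \in s -> f p <= f z.
  elim: s => // x [|x' s] IH _.
    by exists x => [|z]; rewrite inE// => /eqP ->.
  have [//|p ps pmin] := IH.
  have [xp|px] := leP (f x) (f p).
    exists x => [|z]; rewrite inE ?eqxx// => /predU1P[->//|/pmin].
    exact: le_trans.
  exists p => [|z]; rewrite inE ?ps ?orbT// => /predU1P[->|/pmin//].
  exact: ltW.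
have [|p pD' pmin] := seqmin (finmap.enum_fset D').
  by case: (finmap.enum_fset D') (D'y0 : y0 \in finmap.enum_fset D').
have Kp : K p by have := D'K _ pD'; rewrite inE.
have [y D'y] := Kcover _ Kp; rewrite /= ltNge => /negP; apply.
exact: pmin.
Qed.

(** V has a minimum q on the closed unit ball.  On the ray through z with
    n := |z| > 1, convexity between 0 and z bounds V z from below by V 0 plus a
    quadratic in n, using that V (z / n) >= V q; this exceeds V 0 as soon as n
    exceeds the radius r below.  A minimum over the ball of radius r is thus
    global. *)
Lemma strongly_convex_min (R : realType) (N : nat) (m : R)
    (V : 'rV[R]_N -> R) :
  0 < m -> strongly_convex m V -> (forall a, open [set z | a < V z]) ->
  exists p, forall z, V p <= V z.
Proof.
move=> m0 scV lscV.
have cball r : compact [set z : 'rV[R]_N | `|z| <= r].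
  apply: bounded_closed_compact.
    exists r; split; first exact: num_real.
    by move=> M rM z /= zr; rewrite (le_trans zr)// ltW.
  refine (@preimage_closed _ _ (fun z : 'rV[R]_N => `|z|) [set y | y <= r] _ _).
    by move=> z _; exact: norm_continuous.
  exact: closed_le.
have min r : 0 <= r -> exists2 p : 'rV[R]_N, `|p| <= r &
    forall z, `|z| <= r -> V p <= V z.
  move=> r0; apply: (@lower_semicontinuous_min _ _ [set z | `|z| <= r]) => //.
  by exists 0; rewrite /= normr0.
have [q _ qmin] := min 1 ler01.
have V0q : V q <= V 0 by apply: qmin; rewrite normr0.
(* beyond this radius, (m / 2) (n - 1) dominates the possible drop V 0 - V q *)
pose r := 1 + 2 / m * (V 0 - V q).
have r1 : 1 <= r.
  by rewrite lerDl mulr_ge0// ?divr_ge0 ?(ltW m0)// subr_ge0.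
have [p _ pmin] := min r (le_trans ler01 r1).
exists p => z; have [|rz] := leP `|z| r; first exact: pmin.
have Vp0 : V p <= V 0 by apply: pmin; rewrite normr0 (le_trans ler01).
apply: (le_trans Vp0).
set n := `|z| in rz; have n1 : 1 < n := le_lt_trans r1 rz.
have n0 : 0 < n := lt_trans ltr01 n1.
have nV : n^-1 * n = 1 by rewrite mulVf// gt_eqF.
have nle : 0 <= n^-1 <= 1 by rewrite invr_ge0 (ltW n0)/= invf_le1// ltW.
have := scV n^-1 z 0 nle.
rewrite scaler0 addr0 subr0 => scVz.
have Vq : V q <= V (n^-1 *: z).
  by apply: qmin; rewrite normrZ ger0_norm ?nV// invr_ge0 ltW.
have ez : n ^+ 2 <= enorm z ^+ 2.
  by rewrite ler_pXn2r ?nnegrE ?enorm_ge0 ?(ltW n0)// le_norm_enorm.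
have rm : 2 * (V 0 - V q) <= m * (n - 1).
  have : m * (r - 1) <= m * (n - 1) by rewrite ler_pM2l// lerD2r ltW.
  apply: le_trans.
  by rewrite /r addrAC subrr add0r mulrA mulrCA mulfV ?gt_eqF// mulr1.
have c0 : 0 <= m / 2 * (n^-1 * (1 - n^-1)).
  have /andP[i0 i1] := nle.
  by rewrite !mulr_ge0 ?subr_ge0 ?(ltW m0).
have key := ler_wpM2l c0 ez.
have key2 : V q <= n^-1 * V z + (1 - n^-1) * V 0
    - m / 2 * (n^-1 * (1 - n^-1)) * n ^+ 2.
  by apply: (le_trans Vq); apply: (le_trans scVz); rewrite lerD2l lerN2.
have : n * V q <= V z + (n - 1) * V 0 - m / 2 * (n - 1) * n.
  have := ler_wpM2l (ltW n0) key2; congr (_ <= _).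
  by field; rewrite gt_eqF.
have : n * (2 * (V 0 - V q)) <= n * (m * (n - 1)) by rewrite ler_pM2l.
nra.
Qed.

(** * Semicontinuity and measurability *)

Lemma continuous_sqr_enormB (R : realType) (N : nat) (x : 'rV[R]_N) :
  continuous (fun z : 'rV[R]_N => enorm (z - x) ^+ 2).
Proof.
rewrite (_ : (fun z => _) =
  \sum_(i < N) (fun z : 'rV[R]_N => (z 0 i - x 0 i) ^+ 2)); last first.
  apply/funext => z; rewrite sqr_enorm fct_sumE.
  by apply: eq_bigr => i _; rewrite !mxE.
elim/big_ind: _ => [|f g cf cg|i _] z.
- exact: cst_continuous.
- by apply: continuousD; [exact: cf|exact: cg].
- have -> : (fun y : 'rV[R]_N => (y 0 i - x 0 i) ^+ 2) =
      (fun y : 'rV[R]_N => (y 0 i - x 0 i) * (y 0 i - x 0 i)).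
    by apply/funext => y; rewrite expr2.
  have cB : {for z, continuous (fun y : 'rV[R]_N => y 0 i - x 0 i)}.
    by apply: continuousB; [exact: coord_continuous|exact: cst_continuous].
  exact: (continuousM cB cB).
Qed.

Lemma open_prox_objective_gt (R : realType) (N : nat) (lambda : R)
    (phi : 'rV[R]_N -> R) (x : 'rV[R]_N) (a : R) :
  lower_semicontinuous (EFin \o phi) ->
  open [set z | a < prox_objective lambda phi x z].
Proof.
move=> lsc; rewrite openE => z0 /= az0.
set q := fun z : 'rV[R]_N => (2 * lambda)^-1 * enorm (z - x) ^+ 2.
pose d := (phi z0 + q z0 - a) / 2.
have d0 : 0 < d by rewrite divr_gt0// subr_gt0.
have [|U Uz0 phiU] := lsc z0 (phi z0 - d).
  by rewrite lte_fin ltrBlDr ltrDl.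
have qz0 : {for z0, continuous q}.
  apply: continuousM; first exact: cst_continuous.
  exact: continuous_sqr_enormB.
have nearq : \forall z \near z0, q z0 - d < q z.
  by apply: (cvgr_gt _ qz0); rewrite ltrBlDr ltrDl.
near=> z; rewrite /prox_objective -/(q z).
have phiz : phi z0 - d < phi z.
  by rewrite -lte_fin; apply: phiU; near: z.
have qz : q z0 - d < q z by near: z.
have dE : phi z0 + q z0 = a + 2 * d by rewrite /d; field.
by move: phiz qz; rewrite /= -/(q z); lra.
Unshelve. all: by end_near. Qed.

Lemma measurable_coord_ball (R : realType) (N : nat) (c : 'I_N -> R) (r : R) :
  measurable [set t : N.-tuple (measurableTypeR R) |
    forall i, ball (c i) r (tnth t i)].
Proof.
rewrite (_ : [set t | _] = \bigcap_(i in [set: 'I_N])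
    ((fun t : N.-tuple (measurableTypeR R) => tnth t i) @^-1` ball (c i) r)).
  apply: fin_bigcap_measurable => // i _.
  rewrite -[X in measurable X]setTI; apply: measurable_tnth => //.
  exact: measurable_ball.
by apply/seteqP; split => [t h i _|t h i]; exact: h.
Qed.

(** The sup norm makes balls of row vectors into boxes, so an open set is the
    union of the countably many boxes with rational centre and radius
    1 / (n + 1) that it contains, and a box is a finite intersection of
    coordinate conditions. *)
Lemma measurable_row_of_tuple_open (R : realType) (N : nat)
    (U : set 'rV[R]_N) :
  open U -> measurable (@row_of_tuple R N @^-1` U).
Proof.
move=> oU.
pose box (k : 'rV[rat]_N * nat) := [set t : N.-tuple (measurableTypeR R) |
  forall i, ball (ratr (k.1 0 i) : R) k.2.+1%:R^-1 (tnth t i)].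
pose inU k := box k `<=` @row_of_tuple R N @^-1` U.
rewrite (_ : _ @^-1` _ = \bigcup_k [set t | inU k /\ box k t]).
  apply: countable_bigcupT_measurable => [|k]; first exact: countableP.
  have [kU|kU] := pselect (inU k).
    rewrite (_ : [set t | _] = box k); first exact: measurable_coord_ball.
    by apply/seteqP; split => [t []|t].
  by rewrite (_ : [set t | _] = set0)//; apply/seteqP; split => [t []|t].
apply/seteqP; split => [t /= Ut|t [k _ [kU kt]]]; last exact: kU.
move: oU; rewrite openE => /(_ _ Ut).
rewrite /interior/= -nbhs_ballE => -[e /= e0 eU].
have [n n0] : exists n, n.+1%:R^-1 < e / 2.
  have e20 : 0 < e / 2 by rewrite divr_gt0.
  by have [n _ /(_ n (leqnn n))] := near_infty_natSinv_lt (PosNum e20); exists n.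
have rn : 0 < n.+1%:R^-1 :> R by rewrite invr_gt0.
have rat_near i : exists q : rat, ball (ratr q : R) n.+1%:R^-1 (tnth t i).
  have [|q] := @rat_in_itvoo R (tnth t i - n.+1%:R^-1) (tnth t i).
    by rewrite ltrBlDr ltrDl.
  rewrite in_itv/= => /andP[q1 q2]; exists q.
  by rewrite -ball_normE/= ltr_norml; move: rn q1 q2;
    move: n.+1%:R^-1 => r *; apply/andP; split; lra.
have [q qP] := choice rat_near.
exists (\row_i q i, n) => //; split; last by move=> i /=; rewrite mxE.
move=> s /= sbox; apply: eU; split => // i j; rewrite !mxE.
have := sbox j; have := qP j; rewrite mxE/= -!ball_normE/= !ltr_norml.
move: n0; move: n.+1%:R^-1 => r ? /andP[? ?] /andP[? ?].
by apply/andP; split; lra.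
Qed.

Lemma measurable_lsc_row_of_tuple (R : realType) (N : nat)
    (V : 'rV[R]_N -> R) :
  (forall a, open [set z | a < V z]) ->
  measurable_fun [set: N.-tuple (measurableTypeR R)]
    (fun t => V (row_of_tuple t)).
Proof.
move=> lscV; apply: measurability; first exact: RGenOInfty.measurableE.
move=> _ [_ [a ->] <-]; rewrite setTI.
rewrite (_ : _ @^-1` _ = @row_of_tuple R N @^-1` [set z | a < V z]).
  exact: measurable_row_of_tuple_open.
by apply/seteqP; split => t /=; rewrite in_itv/= andbT.
Qed.

(** * Integration over tuples *)

Lemma ge0_integral_lebesgue_tupleS (R : realType) (N : nat)
    (f : N.+1.-tuple (measurableTypeR R) -> \bar R) :
  measurable_fun setT f -> (forall t, (0 <= f t)%E) ->
  (\int[lebesgue_tuple R N.+1]_t f t =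
   \int[@lebesgue_measure R]_a \int[lebesgue_tuple R N]_t
     f (tuple_cons (a, t)))%E.
Proof.
move=> mf f0.
transitivity (\int[@lebesgue_measure R \x lebesgue_tuple R N]_p
    (f \o @tuple_cons R N) p)%E.
  rewrite -[in RHS](preimage_setT (@tuple_cons R N)).
  rewrite -ge0_integral_pushforward//; last exact: measurable_tuple_cons.
rewrite fubini_tonelli1// => [|p]; last exact: f0.
by apply: measurableT_comp => //; exact: measurable_tuple_cons.
Qed.

(** The homothety with centre c and ratio s, which fixes c; centring it at the
    minimiser is what makes strong convexity usable along every ray at once. *)
Definition dilation (R : realType) (N : nat) (c : 'I_N -> R) (s : R)
    (t : N.-tuple (measurableTypeR R)) : N.-tuple (measurableTypeR R) :=
  [tuple c i + s * (tnth t i - c i) | i < N].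

Lemma measurable_dilation (R : realType) (N : nat) (c : 'I_N -> R) (s : R) :
  measurable_fun setT (dilation c s).
Proof.
apply/measurable_fun_tnthP => i.
rewrite (_ : _ \o _ = (fun t => c i + s * (tnth t i - c i))); last first.
  by apply/funext => t; rewrite /= tnth_mktuple.
apply: measurable_funD => //; apply: measurable_funM => //.
by apply: measurable_funB => //; exact: measurable_tnth.
Qed.

Lemma lebesgue_measure_dilation (R : realType) (c s : R)
    (A : set (measurableTypeR R)) (s0 : 0 < s) : measurable A ->
  @lebesgue_measure R A = (s%:E *
    @lebesgue_measure R ((fun a : R => c + s * (a - c))%R @^-1` A))%E.
Proof.
move=> mA.
pose dil (a : measurableTypeR R) : measurableTypeR R := c + s * (a - c).
have mdil : measurable_fun setT dil.
  apply: measurable_funD => //; apply: measurable_funM => //.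
  exact: measurable_funB.
pose nu := mscale (NngNum (ltW s0)) (pushforward (@lebesgue_measure R) dil).
transitivity (nu mdil A); last by [].
apply: (@lebesgue_measure_unique R (nu mdil)) => // _ [[a b]] _ <-.
transitivity (s%:E * @lebesgue_measure R (dil @^-1` `]a, b]))%E; last by [].
rewrite (_ : _ @^-1` _ =
    `](c + s^-1 * (a - c)), (c + s^-1 * (b - c))]%classic); last first.
  apply/funext => y; apply/propext; rewrite /= /dil !in_itv/=.
  rewrite -ltrBlDl -(ltrBrDl _ y) ltr_pdivrMl//.
  by rewrite -lerBrDl -(lerBlDl y) ler_pdivlMl.
rewrite !lebesgue_measure_itv/= !lte_fin ltrD2l ltr_pM2l ?invr_gt0// ltrD2r.
case: ifPn => ab; last by rewrite mule0.
by rewrite -!EFinD -EFinM; congr EFin; field; rewrite gt_eqF.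
Qed.

Lemma ge0_integral_dilation1 (R : realType) (c s : R) (f : R -> \bar R) :
  0 < s -> measurable_fun [set: measurableTypeR R] f ->
  (forall a, (0 <= f a)%E) ->
  (\int[@lebesgue_measure R]_a f a =
   s%:E * \int[@lebesgue_measure R]_a f (c + s * (a - c))%R)%E.
Proof.
move=> s0 mf f0.
pose dil (a : measurableTypeR R) : measurableTypeR R := c + s * (a - c).
have mdil : measurable_fun setT dil.
  apply: measurable_funD => //; apply: measurable_funM => //.
  exact: measurable_funB.
pose nu := mscale (NngNum (ltW s0)) (pushforward (@lebesgue_measure R) dil).
rewrite (@eq_measure_integral _ _ _ _ (nu mdil)) => [|A mA _]; last first.
  exact: (lebesgue_measure_dilation c s0).
by rewrite ge0_integral_mscale// ge0_integral_pushforward.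
Qed.


Lemma measurable_tuple_cons_integral (R : realType) (N : nat)
    (f : N.+1.-tuple (measurableTypeR R) -> \bar R) :
  measurable_fun setT f -> (forall t, (0 <= f t)%E) ->
  measurable_fun [set: measurableTypeR R]
    (fun a => \int[lebesgue_tuple R N]_t f (tuple_cons (a, t)))%E.
Proof.
move=> mf f0.
apply: (@measurable_fun_fubini_tonelli_F _ _ _ _ _ (lebesgue_tuple R N)
  (f \o @tuple_cons R N)) => [|p]; last exact: f0.
by apply: measurableT_comp => //; exact: measurable_tuple_cons.
Qed.

Lemma measurable_tuple_cons_section (R : realType) (N : nat)
    (f : N.+1.-tuple (measurableTypeR R) -> \bar R) (a : R) :
  measurable_fun setT f -> measurable_fun setT (fun t => f (tuple_cons (a, t))).
Proof.
move=> mf; apply: (measurableT_comp mf).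
apply: (measurableT_comp (@measurable_tuple_cons R N)).
exact: measurable_pair1.
Qed.

(** Dilations act on each coordinate separately, which lets the change of
    variables go through Tonelli by induction on the dimension. *)
Lemma dilation_tuple_cons (R : realType) (N : nat) (c : 'I_N.+1 -> R) (s a : R)
    (t : N.-tuple (measurableTypeR R)) :
  dilation c s (tuple_cons (a, t)) =
  tuple_cons (c ord0 + s * (a - c ord0), dilation (c \o lift ord0) s t).
Proof.
apply: eq_from_tnth => i; rewrite tnth_mktuple.
have [j ->|->] := unliftP ord0 i.
  by rewrite /tuple_cons/= !tnthS tnth_mktuple.
by rewrite /tuple_cons/= !tnth0.
Qed.

Lemma ge0_integral_dilation (R : realType) (N : nat) (c : 'I_N -> R) (s : R)
    (f : N.-tuple (measurableTypeR R) -> \bar R) :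
  0 < s -> measurable_fun setT f -> (forall t, (0 <= f t)%E) ->
  (\int[lebesgue_tuple R N]_t f t =
   (s ^+ N)%:E * \int[lebesgue_tuple R N]_t f (dilation c s t))%E.
Proof.
move=> s0; elim: N => [|N IH] in c f *; move=> mf f0.
  rewrite expr0 mul1e; apply: eq_integral => t _.
  by rewrite [dilation _ _ _]tuple0 [t]tuple0.
rewrite !ge0_integral_lebesgue_tupleS//; last first.
  by apply: measurableT_comp => //; exact: measurable_dilation.
rewrite (@ge0_integral_dilation1 R (c ord0) s)//; first last.
- by move=> a; apply: integral_ge0.
- exact: measurable_tuple_cons_integral.
rewrite exprS EFinM -muleA; congr (_ * _)%E.
rewrite -ge0_integralZl//; first last.
- by rewrite lee_fin exprn_ge0// ltW.
- by move=> a _; apply: integral_ge0.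
- apply: (@measurable_tuple_cons_integral _ _ (fun t => f (dilation c s t))) => //.
  by apply: measurableT_comp => //; exact: measurable_dilation.
apply: eq_integral => a _.
rewrite (IH (c \o lift ord0))//; last exact: measurable_tuple_cons_section.
by congr (_ * _)%E; apply: eq_integral => t _; rewrite dilation_tuple_cons.
Qed.

Lemma lebesgue_tupleT_neq0 (R : realType) (N : nat) :
  lebesgue_tuple R N setT != 0%E.
Proof.
rewrite gt_eqF//; elim: N => [|N IH].
  by rewrite /= diracT.
have -> : lebesgue_tuple R N.+1 setT =
    (@lebesgue_measure R setT * lebesgue_tuple R N setT)%E.
  rewrite -[LHS]mul1e -(integral_cst (lebesgue_tuple R N.+1))//.
  rewrite ge0_integral_lebesgue_tupleS//.
  under eq_integral do rewrite integral_cst// mul1e.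
  by rewrite integral_cst// muleC.
rewrite -set_itvNyy lebesgue_measure_itv/=.
by apply: mule_gt0 => //; rewrite addye// ltry.
Qed.

(** * Integrability of functions of Gaussian decay *)

Lemma integral_gauss_lty (R : realType) (c b : R) : 0 < b ->
  (\int[@lebesgue_measure R]_a (expR (- b * (a - c) ^+ 2))%:E < +oo)%E.
Proof.
move=> b0; pose s := Num.sqrt (2 * b)^-1.
have s2 : s ^+ 2 = (2 * b)^-1 by rewrite sqr_sqrtr// invr_ge0 mulr_ge0 ?ltW.
have s0 : s != 0 by rewrite gt_eqF// sqrtr_gt0 invr_gt0 mulr_gt0.
have peak0 : 0 < normal_peak s by rewrite normal_peak_gt0.
rewrite (eq_integral (fun a : measurableTypeR R => ((normal_peak s)^-1)%:E *
    (normal_pdf c s a)%:E)%E) => [|a _]; last first.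
  rewrite -EFinM normal_pdfE//= [in RHS]mulrA mulVf ?gt_eqF// mul1r /normal_fun s2.
  by congr (expR _)%:E; field; rewrite gt_eqF.
rewrite ge0_integralZl//; first last.
- by rewrite lee_fin invr_ge0 ltW.
- by move=> a _; rewrite lee_fin normal_pdf_ge0.
- by apply/measurable_EFinP; exact: measurable_normal_pdf.
by rewrite integral_normal_pdf mule1 ltry.
Qed.

Lemma measurable_expR_sum_sqr (R : realType) (N : nat) (c : 'I_N -> R) (b : R) :
  measurable_fun [set: N.-tuple (measurableTypeR R)]
    (fun t => expR (- b * \sum_(i < N) (tnth t i - c i) ^+ 2)).
Proof.
apply: measurableT_comp => //; apply: measurable_funM => //.
apply: measurable_sum => i; apply: measurable_funX; apply: measurable_funB => //.
exact: measurable_tnth.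
Qed.

Lemma integral_tuple_gauss_lty (R : realType) (N : nat) (c : 'I_N -> R) (b : R) :
  0 < b ->
  (\int[lebesgue_tuple R N]_t
     (expR (- b * \sum_(i < N) (tnth t i - c i) ^+ 2))%:E < +oo)%E.
Proof.
move=> b0; elim: N => [|N IH] in c *.
  under eq_integral do rewrite big_ord0 mulr0 expR0.
  by rewrite integral_cst// mul1e /= diracT ltry.
rewrite ge0_integral_lebesgue_tupleS//; last first.
  by apply/measurable_EFinP; exact: measurable_expR_sum_sqr.
pose g a := expR (- b * (a - c ord0) ^+ 2).
pose J := (\int[lebesgue_tuple R N]_t
  (expR (- b * \sum_(i < N) (tnth t i - c (lift ord0 i)) ^+ 2))%:E)%E.
have J0 : (0 <= J)%E by apply: integral_ge0 => t _; rewrite lee_fin expR_ge0.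
rewrite (eq_integral (fun a : measurableTypeR R => (g a)%:E * J)%E)
  => [|a _]; last first.
  rewrite -ge0_integralZl//; first last.
  - by rewrite lee_fin expR_ge0.
  - by apply/measurable_EFinP; exact: measurable_expR_sum_sqr.
  apply: eq_integral => t _; rewrite -EFinM -expRD -mulrDr big_ord_recl.
  congr (expR (_ * (_ + _)))%:E.
  by apply: eq_bigr => i _; rewrite /tuple_cons/= tnthS.
rewrite ge0_integralZr//; first last.
- by move=> a _; rewrite lee_fin expR_ge0.
- apply/measurable_EFinP; apply: measurableT_comp => //.
  apply: measurable_funM => //; apply: measurable_funX; exact: measurable_funB.
have Jy : (J < +oo)%E by exact: (IH (c \o lift ord0)).
have gy : (\int[@lebesgue_measure R]_a (g a)%:E < +oo)%E.
  exact: integral_gauss_lty.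
apply: lte_mul_pinfty => //.
- by apply: integral_ge0 => a _; rewrite lee_fin expR_ge0.
- by rewrite ge0_fin_numE// integral_ge0// => a _; rewrite lee_fin expR_ge0.
Qed.

Lemma sqr_enorm_row_of_tuple (R : realType) (N : nat)
    (t : N.-tuple (measurableTypeR R)) (p : 'rV[R]_N) :
  enorm (row_of_tuple t - p) ^+ 2 = \sum_(i < N) (tnth t i - p 0 i) ^+ 2.
Proof. by rewrite sqr_enorm; apply: eq_bigr => i _; rewrite !mxE. Qed.

(** Completing the square, k D - b D^2 <= k^2 / (2 b) - (b / 2) D^2: half of the
    Gaussian decay absorbs any exponential growth. *)
Lemma integrable_le_gauss (R : realType) (N : nat) (p : 'rV[R]_N) (K k b : R)
    (f : N.-tuple (measurableTypeR R) -> R) :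
  0 < b -> 0 <= K -> measurable_fun setT f ->
  (forall t, let D := enorm (row_of_tuple t - p) in
    `|f t| <= K * expR (k * D - b * D ^+ 2)) ->
  (lebesgue_tuple R N).-integrable setT (EFin \o f).
Proof.
move=> b0 K0 mf fK.
pose G t := expR (- (b / 2) *
  \sum_(i < N) (tnth (t : N.-tuple (measurableTypeR R)) i - p 0 i) ^+ 2).
have mG : measurable_fun setT G by exact: measurable_expR_sum_sqr.
have iG : (lebesgue_tuple R N).-integrable setT (EFin \o G).
  apply/integrableP; split; first exact/measurable_EFinP.
  under eq_integral do rewrite gee0_abs ?lee_fin ?expR_ge0//.
  by apply: integral_tuple_gauss_lty; rewrite divr_gt0.
have iKG := integrableZl _ (K * expR (k ^+ 2 / (2 * b))) iG.
apply: (le_integrable _ _ _ (iKG _)) => //.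
  exact/measurable_EFinP.
move=> t _; rewrite /= !lee_fin [leRHS]ger0_norm; last first.
  by rewrite !mulr_ge0// expR_ge0.
apply: (le_trans (fK t)); rewrite -mulrA ler_wpM2l// -expRD ler_expR.
rewrite -sqr_enorm_row_of_tuple; set D := enorm _.
have h : 0 <= b / 2 * (D - k / b) ^+ 2.
  by rewrite mulr_ge0 ?sqr_ge0// divr_ge0// ltW.
rewrite -subr_ge0; congr (_ <= _): h; field; rewrite gt_eqF//.
Qed.

(** * Strong convexity at the minimiser *)

(** All passages to the limit below are instances of this, with h measuring how
    far a convex combination or a dilation is from its limit position. *)
Lemma le_of_forall_small (R : realType) (A B C : R) :
  (forall h, 0 < h < 1 -> A - h * B <= C) -> A <= C.
Proof.
move=> ABC; apply/ler_addgt0Pr => e e0.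
pose h := Num.min (1 / 2) (e / (`|B| + 1)).
have B1 : 0 < `|B| + 1 by rewrite ltr_wpDl.
have h0 : 0 < h by rewrite lt_min !divr_gt0.
have h1 : h < 1 by rewrite gt_min; apply/orP; left; lra.
have he : h * (`|B| + 1) <= e by rewrite -ler_pdivlMr// ge_min lexx orbT.
have hB : h * B <= h * (`|B| + 1).
  by rewrite ler_pM2l// (le_trans (ler_norm B))// lerDl.
by have := ABC h; rewrite h0 h1 => /(_ isT); lra.
Qed.

Lemma bernoulli_ineq (R : realType) (N : nat) (h : R) :
  0 <= h <= 1 -> 1 - N%:R * h <= (1 - h) ^+ N.
Proof.
move=> /andP[h0 h1]; elim: N => [|N IH]; first by rewrite expr0 mul0r subr0.
have := ler_wpM2l (_ : 0 <= 1 - h) IH; rewrite subr_ge0 => /(_ h1).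
rewrite exprS; apply: le_trans; rewrite -natr1.
have : 0 <= N%:R * (h * h) by rewrite !mulr_ge0.
lra.
Qed.

(** Compare V p with the value of V at p + h (z - p), divide by h and let h
    tend to 0. *)
Lemma strongly_convex_growth (R : realType) (N : nat) (m : R)
    (V : 'rV[R]_N -> R) (p z : 'rV[R]_N) :
  strongly_convex m V -> (forall y, V p <= V y) ->
  V p + m / 2 * enorm (z - p) ^+ 2 <= V z.
Proof.
move=> scV pmin; rewrite addrC -lerBrDr.
apply: (@le_of_forall_small _ _ (m / 2 * enorm (z - p) ^+ 2)) => h /andP[h0 h1].
have h01 : 0 <= h <= 1 by rewrite !ltW.
have := le_trans (pmin _) (scV h z p h01).
rewrite -subr_ge0 => H; rewrite -(ler_pM2l h0) -subr_ge0.
by apply: le_trans H _; rewrite le_eqVlt; apply/orP; left; apply/eqP; ring.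
Qed.

(** Strong convexity between p and z contributes s (1 - s) of the quadratic
    term, and the growth V z - V p contributes 1 - s; together they make
    (1 - s) (1 + s). *)
Lemma strongly_convex_radial (R : realType) (N : nat) (m s : R)
    (V : 'rV[R]_N -> R) (p z : 'rV[R]_N) :
  strongly_convex m V -> (forall y, V p <= V y) -> 0 <= s <= 1 ->
  V (s *: z + (1 - s) *: p) + (1 - s ^+ 2) * (m / 2 * enorm (z - p) ^+ 2)
  <= V z.
Proof.
move=> scV pmin s01; have /andP[s0 s1] := s01.
have H1 := scV s z p s01.
have s1' : 0 <= 1 - s by rewrite subr_ge0.
have H2 := ler_wpM2l s1' (strongly_convex_growth z scV pmin).
lra.
Qed.

Lemma row_of_tuple_dilation (R : realType) (N : nat) (p : 'rV[R]_N) (s : R)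
    (t : N.-tuple (measurableTypeR R)) :
  row_of_tuple (dilation (p 0) s t) = s *: row_of_tuple t + (1 - s) *: p.
Proof. by apply/rowP => i; rewrite !mxE tnth_mktuple; ring. Qed.

(** * The density exp (- V / eps) *)

Lemma EFin_Rintegral d (T : measurableType d) (R : realType)
    (mu : {measure set T -> \bar R}) (f : T -> R) :
  mu.-integrable setT (EFin \o f) ->
  (\int[mu]_t f t)%:E = (\int[mu]_t (f t)%:E)%E.
Proof. by move=> intf; rewrite fineK// integrable_fin_num. Qed.

Lemma Rintegral_sum d (T : measurableType d) (R : realType)
    (mu : {measure set T -> \bar R}) (I : Type) (r : seq I)
    (f : I -> T -> R) :
  (forall i, mu.-integrable setT (EFin \o f i)) ->
  \int[mu]_t (\sum_(i <- r) f i t) = \sum_(i <- r) \int[mu]_t f i t.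
Proof.
move=> intf.
have -> : \int[mu]_t (\sum_(i <- r) f i t) =
    fine (\int[mu]_t (\sum_(i <- r) (f i t)%:E))%E.
  by congr fine; apply: eq_integral => t _; rewrite sumEFin.
rewrite integral_sum//.
rewrite -[RHS]/(fine _%:E) -sumEFin; congr fine; apply: eq_bigr => i _.
by rewrite EFin_Rintegral.
Qed.

(** The unnormalised Gibbs density of the potential V at temperature eps. *)
Definition gibbs (R : realType) (N : nat) (eps : R) (V : 'rV[R]_N -> R)
    (t : N.-tuple (measurableTypeR R)) : R :=
  expR (- V (row_of_tuple t) / eps).

Lemma measurable_gibbs (R : realType) (N : nat) (eps : R)
    (V : 'rV[R]_N -> R) :
  (forall a, open [set z | a < V z]) -> measurable_fun setT (gibbs eps V).
Proof.
move=> lscV; apply: measurableT_comp => //; apply: measurable_funM => //.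
by apply: measurableT_comp => //; exact: measurable_lsc_row_of_tuple.
Qed.

(** By quadratic growth at the minimiser, the Gibbs density is at most
    exp (- V p / eps) times a Gaussian centred at p. *)
Lemma integrable_gibbsM (R : realType) (N : nat) (m eps K k : R)
    (V : 'rV[R]_N -> R) (p : 'rV[R]_N) (f : N.-tuple (measurableTypeR R) -> R) :
  0 < m -> 0 < eps -> strongly_convex m V ->
  (forall a, open [set z | a < V z]) -> (forall z, V p <= V z) ->
  measurable_fun setT f ->
  (forall t, `|f t| <= K * expR (k * enorm (row_of_tuple t - p))) ->
  (lebesgue_tuple R N).-integrable setT
    (EFin \o (fun t => gibbs eps V t * f t)).
Proof.
move=> m0 e0 scV lscV pmin mf fK.
have K0 : 0 <= K.
  have := le_trans (normr_ge0 _) (fK [tuple of nseq N 0]).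
  by rewrite pmulr_lge0// expR_gt0.
apply: (@integrable_le_gauss _ _ p (expR (- V p / eps) * K) k (m / (2 * eps))).
- by rewrite divr_gt0// mulr_gt0.
- by rewrite mulr_ge0// expR_ge0.
- by apply: measurable_funM => //; exact: measurable_gibbs.
move=> t /=; rewrite normrM ger0_norm ?expR_ge0//.
set D := enorm _.
have gD : gibbs eps V t <= expR (- V p / eps - m / (2 * eps) * D ^+ 2).
  rewrite ler_expR; have := strongly_convex_growth (row_of_tuple t) scV pmin.
  rewrite -/D => H.
  have : (V p + m / 2 * D ^+ 2) / eps <= V (row_of_tuple t) / eps.
    by rewrite ler_pM2r ?invr_gt0.
  rewrite [X in X <= _ -> _](_ : _ = V p / eps + m / (2 * eps) * D ^+ 2).
    by lra.
  by field; rewrite gt_eqF.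
apply: (le_trans (ler_pM (expR_ge0 _) (normr_ge0 _) gD (fK t))).
rewrite -/D [leRHS]mulrAC [leRHS]mulrC mulrCA -!expRD.
by rewrite ler_wpM2l// ler_expR le_eqVlt; apply/orP; left; apply/eqP; ring.
Qed.

Section gibbs_moments.
Context (R : realType) (N : nat) (m eps : R) (V : 'rV[R]_N -> R).
Context (p : 'rV[R]_N).
Hypotheses (m0 : 0 < m) (eps0 : 0 < eps) (scV : strongly_convex m V).
Hypotheses (lscV : forall a, open [set z | a < V z]).
Hypotheses (pmin : forall z, V p <= V z).
Local Notation mu := (lebesgue_tuple R N).
Local Notation w := (gibbs eps V).
Local Notation T := (N.-tuple (measurableTypeR R)).

Let gibbsM K k f :=
  @integrable_gibbsM R N m eps K k V p f m0 eps0 scV lscV pmin.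

Lemma integrable_gibbs : mu.-integrable setT (EFin \o w).
Proof.
rewrite (_ : w = (fun t => w t * 1)); last by apply/funext => t; rewrite mulr1.
by apply: (@gibbsM 1 0) => // t; rewrite normr1 mul0r expR0 mulr1.
Qed.

(** The density is positive everywhere and the space has nonzero measure. *)
Lemma gibbs_partition_gt0 : 0 < \int[mu]_t w t.
Proof.
rewrite lt_neqAle Rintegral_ge0 ?andbT; last by move=> t _; exact: expR_ge0.
apply/eqP => Z0.
have wE0 : (\int[mu]_t `|(w t)%:E| = 0)%E.
  rewrite -[RHS]/(0%:E) Z0 EFin_Rintegral; last exact: integrable_gibbs.
  by apply: eq_integral => t _; rewrite gee0_abs// lee_fin expR_ge0.
have mw : measurable_fun setT (EFin \o w).
  by apply/measurable_EFinP; exact: measurable_gibbs.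
have /(ae_eq_integral_abs mu measurableT mw)[A [mA A0 TA]] := wE0.
have AT : A = setT.
  apply/seteqP; split => // t _; apply: TA => /= /(_ I) [] /eqP.
  by rewrite gt_eqF// expR_gt0.
by have := lebesgue_tupleT_neq0 R N; rewrite -AT A0 eqxx.
Qed.

Lemma coord_dist_le (c : R) (i : 'I_N) (t : T) :
  `|tnth t i - c| <= `|p 0 i - c| + enorm (row_of_tuple t - p).
Proof.
rewrite (_ : tnth t i - c = (p 0 i - c) + (tnth t i - p 0 i)); last by ring.
apply: (le_trans (ler_normD _ _)); rewrite lerD2l.
by have := le_coord_enorm (row_of_tuple t - p) i; rewrite !mxE.
Qed.

Lemma measurable_coordB (c : R) (i : 'I_N) :
  measurable_fun setT (fun t : T => tnth t i - c).
Proof. by apply: measurable_funB => //; exact: measurable_tnth. Qed.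

(** The exponential moments of a coordinate dominate its polynomial moments and
    the difference quotients of its Laplace transform. *)
Lemma integrable_gibbs_expR (c k : R) (i : 'I_N) :
  mu.-integrable setT (EFin \o (fun t => w t * expR (k * `|tnth t i - c|))).
Proof.
apply: (@gibbsM (expR (`|k| * `|p 0 i - c|)) `|k|) => [|t].
  apply: measurableT_comp => //; apply: measurable_funM => //.
  by apply: measurableT_comp => //; exact: measurable_coordB.
rewrite ger0_norm ?expR_ge0// -expRD ler_expR -mulrDr.
apply: (@le_trans _ _ (`|k| * `|tnth t i - c|)).
  by rewrite ler_wpM2r// ler_norm.
by rewrite ler_wpM2l// coord_dist_le.
Qed.

Lemma integrable_gibbs_coord (c : R) (i : 'I_N) :
  mu.-integrable setT (EFin \o (fun t => w t * (tnth t i - c))).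
Proof.
apply: (le_integrable _ _ _ (integrable_gibbs_expR c 1 i)) => //.
  apply/measurable_EFinP; apply: measurable_funM; first exact: measurable_gibbs.
  exact: measurable_coordB.
move=> t _; rewrite /= lee_fin !normrM ler_wpM2l//.
rewrite mul1r [leRHS]ger0_norm ?expR_ge0//.
by apply: le_trans (expR_ge1Dx _); rewrite lerDr.
Qed.

Lemma integrable_gibbs_sqr (c : R) (i : 'I_N) :
  mu.-integrable setT (EFin \o (fun t => w t * (tnth t i - c) ^+ 2)).
Proof.
apply: (le_integrable _ _ _ (integrable_gibbs_expR c 2 i)) => //.
  apply/measurable_EFinP; apply: measurable_funM; first exact: measurable_gibbs.
  by apply: measurable_funX; exact: measurable_coordB.
move=> t _; rewrite /= lee_fin normrM [leRHS]normrM ler_wpM2l//.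
rewrite [leRHS]ger0_norm ?expR_ge0//.
rewrite normrX expRM_natl ler_pXn2r ?nnegrE ?expR_ge0//.
by apply: le_trans (expR_ge1Dx _); rewrite lerDr.
Qed.

(** Replaces the integration by parts of div ((z - p) w): Z is compared with
    the integral of w dilated about p by s = 1 - h, and the terms of first
    order in h are kept. *)
Lemma gibbs_second_moment :
  m / eps * (\sum_(i < N) \int[mu]_t (w t * (tnth t i - p 0 i) ^+ 2)) <=
  N%:R * \int[mu]_t w t.
Proof.
set Z := Rintegral _ _ _.
rewrite -Rintegral_sum => [|i]; last exact: integrable_gibbs_sqr.
set M := Rintegral _ _ _.
have intM : mu.-integrable setT
    (EFin \o (fun t => \sum_(i < N) w t * (tnth t i - p 0 i) ^+ 2)).
  rewrite (_ : _ \o _ =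
      (fun t => \sum_(i < N) (w t * (tnth t i - p 0 i) ^+ 2)%:E)%E).
    by apply: integrable_sum => // i _; exact: integrable_gibbs_sqr.
  by apply/funext => t; rewrite /= sumEFin.
have sum0 t : 0 <= \sum_(i < N) w t * (tnth t i - p 0 i) ^+ 2.
  by apply: sumr_ge0 => i _; rewrite mulr_ge0 ?sqr_ge0 ?expR_ge0.
have M0 : 0 <= M by apply: Rintegral_ge0 => t _; exact: sum0.
pose c := m / (2 * eps).
have c0 : 0 < c by rewrite divr_gt0// mulr_gt0.
(* the change of variables combined with strong convexity along rays *)
have dil s : 0 < s -> s <= 1 -> s ^+ N * (Z + (1 - s ^+ 2) * c * M) <= Z.
  move=> s0 s1; rewrite -lee_fin EFinM EFinD EFinM /Z /M.
  rewrite !EFin_Rintegral//; last exact: integrable_gibbs.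
  rewrite [leRHS](@ge0_integral_dilation R N (p 0) s (EFin \o w))//; first last.
  - by move=> t; rewrite lee_fin expR_ge0.
  - by apply/measurable_EFinP; exact: measurable_gibbs.
  apply: lee_wpmul2l; first by rewrite lee_fin exprn_ge0// ltW.
  have s1' : 0 <= (1 - s ^+ 2) * c.
    by rewrite mulr_ge0 ?(ltW c0)// subr_ge0 exprn_ile1 // ltW.
  rewrite -ge0_integralZl//; first last.
  - by move=> t _; rewrite lee_fin.
  - by have /integrableP[] := intM.
  rewrite -ge0_integralD//; first last.
  - by apply: measurable_funeM; have /integrableP[] := intM.
  - by move=> t _; rewrite mule_ge0// lee_fin.
  - by apply/measurable_EFinP; exact: measurable_gibbs.
  - by move=> t _; rewrite lee_fin expR_ge0.
  apply: ge0_le_integral => //.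
  - by move=> t _; rewrite adde_ge0 ?lee_fin ?expR_ge0// mulr_ge0.
  - apply: emeasurable_funD.
      by apply/measurable_EFinP; exact: measurable_gibbs.
    by apply: measurable_funeM; have /integrableP[] := intM.
  - apply/measurable_EFinP.
    apply: measurableT_comp; first exact: measurable_gibbs.
    exact: measurable_dilation.
  move=> t _; rewrite -EFinM -EFinD lee_fin -mulr_sumr -sqr_enorm_row_of_tuple.
  rewrite /gibbs row_of_tuple_dilation.
  have s01 : 0 <= s <= 1 by rewrite ltW.
  have rad := strongly_convex_radial (row_of_tuple t) scV pmin s01.
  set D2 := enorm _ ^+ 2 in rad *; set z := s *: _ + _ in rad *.
  rewrite mulrCA -[X in X + _]mulr1 -mulrDr.
  have -> : - V z / eps =
      - V (row_of_tuple t) / eps + (V (row_of_tuple t) - V z) / eps.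
    by ring.
  rewrite expRD ler_wpM2l ?expR_ge0//; apply: le_trans (expR_ge1Dx _).
  rewrite lerD2l ler_pdivlMr//.
  have -> : (1 - s ^+ 2) * c * D2 * eps = (1 - s ^+ 2) * (m / 2 * D2).
    by rewrite /c; field; rewrite gt_eqF.
  by lra.
have Z0 : 0 <= Z by exact/ltW/gibbs_partition_gt0.
have -> : m / eps * M = 2 * c * M by rewrite /c; field; rewrite gt_eqF.
apply: (@le_of_forall_small _ _ ((2 * N%:R + 1) * (c * M))) => h /andP[h0 h1].
have h01 : 0 <= h <= 1 by rewrite !ltW.
(* Bernoulli bounds 1 - (1 - h)^N by N h, the factor N of the conclusion *)
have B := bernoulli_ineq N h01.
have := dil (1 - h); rewrite subr_gt0 h1 gerBl (ltW h0) => /(_ isT isT).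
set q := (1 - h) ^+ N in B *; move=> dh.
have cM : 0 <= c * M by rewrite mulr_ge0// ltW.
rewrite -(ler_pM2l h0).
have X0 : 0 <= (2 - h) * (c * M).
  by rewrite mulr_ge0 //; lra.
have e1 := ler_wpM2r (mulr_ge0 (ltW h0) X0) B.
have e2 := ler_wpM2r Z0 B.
have e3 : 0 <= h * h * h * N%:R * (c * M).
  by rewrite (mulr_ge0 _ cM)// !mulr_ge0 ?ler0n ?(ltW h0).
move: dh e1 e2 e3 {dil B sum0 M0 intM Z0 c0 cM X0}; clearbody q M Z c.
by lra.
Qed.


Lemma gibbs_coord_shift (c c' : R) (i : 'I_N) :
  \int[mu]_t (w t * (tnth t i - c)) =
  \int[mu]_t (w t * (tnth t i - c')) + (c' - c) * \int[mu]_t w t.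
Proof.
rewrite -RintegralZl//; last exact: integrable_gibbs.
rewrite -RintegralD//; last first.
- exact: (integrableZl _ (c' - c) integrable_gibbs).
- exact: integrable_gibbs_coord.
by apply: eq_Rintegral => t _; ring.
Qed.

(** Jensen for the square: with q the mean, integrate the pointwise bound
    2 q y - q^2 <= y^2 for y the centred coordinate. *)
Lemma gibbs_mean_sqr (c : R) (i : 'I_N) :
  (\int[mu]_t (w t * (tnth t i - c)) / \int[mu]_t w t) ^+ 2 <=
  (\int[mu]_t (w t * (tnth t i - c) ^+ 2)) / \int[mu]_t w t.
Proof.
set Z := \int[mu]_t w t; set a := Rintegral _ _ _; set S := Rintegral _ _ _.
have Z0 : 0 < Z by exact: gibbs_partition_gt0.
pose q := a / Z.
have iB : mu.-integrable setT
    (EFin \o (fun t => 2 * q * (w t * (tnth t i - c)))).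
  exact: (integrableZl _ (2 * q) (integrable_gibbs_coord c i)).
have iC : mu.-integrable setT (EFin \o (fun t => q ^+ 2 * w t)).
  exact: (integrableZl _ (q ^+ 2) integrable_gibbs).
have : \int[mu]_t (2 * q * (w t * (tnth t i - c)) - q ^+ 2 * w t) <= S.
  apply: le_Rintegral => //.
  - exact: (integrableB _ iB iC).
  - exact: integrable_gibbs_sqr.
  move=> t _; have : 0 <= w t * (tnth t i - c - q) ^+ 2.
    by rewrite mulr_ge0 ?sqr_ge0 ?expR_ge0.
  by rewrite -subr_ge0 => h; rewrite -subr_ge0; apply: le_trans h _;
    rewrite le_eqVlt; apply/orP; left; apply/eqP; ring.
rewrite RintegralB// !RintegralZl//; first last.
- exact: integrable_gibbs_coord.
- exact: integrable_gibbs.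
rewrite -/a -/Z ler_pdivlMr// -/q.
have -> : a = q * Z by rewrite /q mulfVK// gt_eqF.
by lra.
Qed.

Lemma integrable_gibbs_laplace (c k h : R) (i : 'I_N) :
  mu.-integrable setT
    (EFin \o (fun t => w t * expR (h * (k * (tnth t i - c))))).
Proof.
apply: (le_integrable _ _ _ (integrable_gibbs_expR c `|h * k| i)) => //.
  apply/measurable_EFinP; apply: measurable_funM; first exact: measurable_gibbs.
  apply: measurableT_comp => //; apply: measurable_funM => //.
  by apply: measurable_funM => //; exact: measurable_coordB.
move=> t _; rewrite /= lee_fin normrM [leRHS]normrM ler_wpM2l//.
rewrite [leLHS]ger0_norm ?expR_ge0// [leRHS]ger0_norm ?expR_ge0//.
by rewrite ler_expR mulrA -normrM ler_norm.
Qed.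

(** Differentiation under the integral at h = 0.  For |h| < 1 the derivative of
    exp (h X) is bounded by |X| exp |X| <= exp (2 |X|). *)
Lemma is_derive_gibbs_laplace (c k : R) (i : 'I_N) :
  is_derive (0 : R) (1 : R)
    (fun h : R => \int[mu]_t (w t * expR (h * (k * (tnth t i - c)))))
    (k * \int[mu]_t (w t * (tnth t i - c))).
Proof.
pose X (t : T) := k * (tnth t i - c).
pose f (h : R) (t : T) := w t * expR (h * X t).
pose G (t : T) := w t * expR (2 * `|k| * `|tnth t i - c|).
have df (h : R) (t : T) :
    is_derive h (1 : R) (f ^~ t) (w t * (X t * expR (h * X t))).
  have d1 : is_derive h (1 : R) (fun h : R => h * X t) (X t).
    by apply: is_derive_eq; rewrite scaler0 add0r /GRing.scale/= mulr1.
  have d2 := @is_derive1_comp R expR (fun h : R => h * X t) h _ _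
    (is_derive_expR _) d1.
  by apply: is_derive_eq; rewrite /GRing.scale/=; ring.
have derE (h : R) (t : T) : partial1of2 f h t = w t * (X t * expR (h * X t)).
  by rewrite partial1of2E; apply: derive_val.
have I0 : `](-1), 1[%classic (0 : R) by rewrite /= in_itv/=; lra.
have intf (h : R) : `](-1), 1[%classic h -> mu.-integrable setT (EFin \o f h).
  by move=> _; exact: integrable_gibbs_laplace.
have der (h : R) (t : T) : `](-1), 1[%classic h -> setT t ->
    derivable (f ^~ t) h 1.
  by move=> _ _; exact: ex_derive.
have G0 t : 0 <= G t by rewrite mulr_ge0 ?expR_ge0.
have intG : mu.-integrable setT (EFin \o G) by exact: integrable_gibbs_expR.
have Gub (h : R) (t : T) : `](-1), 1[%classic h -> setT t ->
    `|partial1of2 f h t| <= G t.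
  rewrite /= in_itv/= => /andP[h1 h2] _; rewrite derE.
  rewrite normrM ger0_norm ?expR_ge0// ler_wpM2l ?expR_ge0//.
  rewrite normrM [X in _ * X]ger0_norm ?expR_ge0//.
  have Xe : `|X t| <= expR `|X t|.
    by apply: le_trans (expR_ge1Dx _); rewrite lerDr.
  have hX : expR (h * X t) <= expR `|X t|.
    rewrite ler_expR (le_trans (ler_norm _))// normrM ler_piMl//.
    by rewrite ler_norml; apply/andP; split; apply: ltW.
  apply: (le_trans (ler_pM (normr_ge0 _) (expR_ge0 _) Xe hX)).
  by rewrite -expRD ler_expR /X normrM le_eqVlt; apply/orP; left; apply/eqP; ring.
have dF := derivable_under_integral measurableT I0 intf der G0 intG Gub.
have eF := differentiation_under_integral measurableT I0 intf der G0 intG Gub.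
apply: DeriveDef; first exact: dF.
rewrite -derive1E eF -RintegralZl//; last exact: integrable_gibbs_coord.
apply: eq_Rintegral => t _.
by rewrite derE mul0r expR0 /X; ring.
Qed.

End gibbs_moments.

(** * The approximate proximal map as a Gibbs mean *)

(** Expanding the square turns a displacement of the centre along the i-th axis
    into an exponential tilt of the Gibbs density, so the Cole-Hopf integral on
    the line through x is a Laplace transform in h, up to an even Gaussian
    factor whose derivative vanishes at h = 0. *)
Lemma cole_hopf_integrand_shift (R : realType) (N : nat) (eps lambda h : R)
    (phi : 'rV[R]_N -> R) (x : 'rV[R]_N) (i : 'I_N)
    (t : N.-tuple (measurableTypeR R)) :
  0 < eps -> 0 < lambda ->
  expR (- phi (row_of_tuple t) / eps
        - enorm (h *: delta_mx 0 i + x - row_of_tuple t) ^+ 2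
          / (2 * eps * lambda)) =
  expR (- h ^+ 2 / (2 * eps * lambda)) *
  (gibbs eps (prox_objective lambda phi x) t *
   expR (h * ((eps * lambda)^-1 * (tnth t i - x 0 i)))).
Proof.
move=> e0 l0; rewrite /gibbs -!expRD; congr expR; rewrite /prox_objective.
have -> : enorm (h *: delta_mx 0 i + x - row_of_tuple t) ^+ 2 =
    enorm (row_of_tuple t - x) ^+ 2 - 2 * h * (tnth t i - x 0 i) + h ^+ 2.
  rewrite !sqr_enorm (bigD1 i)//= [in RHS](bigD1 i)//=.
  rewrite (eq_bigr (fun j => (row_of_tuple t - x) 0 j ^+ 2)) => [|j ji].
    by rewrite !mxE !eqxx /=; ring.
  by rewrite !mxE (negbTE ji) andbF /=; ring.
by field; rewrite !gt_eqF.
Qed.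

(** With L the Laplace transform above, the gradient has i-th coordinate
    - eps L'(0) / L(0), where L(0) = Z and L'(0) is (eps lambda)^-1 times the
    integral of w (z_i - x_i); multiplying by - lambda cancels the constants. *)
Lemma typef_approxE (R : realType) (N : nat) (m eps lambda : R)
    (phi : 'rV[R]_N -> R) (x p : 'rV[R]_N) (i : 'I_N) :
  let V := prox_objective lambda phi x in
  0 < m -> 0 < eps -> 0 < lambda -> strongly_convex m V ->
  (forall a, open [set z | a < V z]) -> (forall z, V p <= V z) ->
  typef_approx eps lambda phi x 0 i =
  x 0 i + (\int[lebesgue_tuple R N]_t (gibbs eps V t * (tnth t i - x 0 i)))
          / \int[lebesgue_tuple R N]_t gibbs eps V t.
Proof.
move=> V m0 e0 l0 scV lscV pmin.
have Z0 := gibbs_partition_gt0 m0 e0 scV lscV pmin.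
set Z := Rintegral _ _ (gibbs eps V) in Z0 *.
set A := Rintegral _ _ _.
pose k := (eps * lambda)^-1.
pose L (h : R) := \int[lebesgue_tuple R N]_t
  (gibbs eps V t * expR (h * (k * (tnth t i - x 0 i)))).
have dL : is_derive (0 : R) (1 : R) L (k * A).
  exact: (is_derive_gibbs_laplace m0 e0 scV lscV pmin).
have L0 : L 0 = Z.
  by apply: eq_Rintegral => t _; rewrite mul0r expR0 mulr1.
set C := ((2 * pi * eps * lambda) `^ (N%:R / 2))^-1.
have C0 : 0 < C by rewrite invr_gt0 powR_gt0// !mulr_gt0// pi_gt0.
pose E (h : R) := expR (- h ^+ 2 / (2 * eps * lambda)).
have lineE (h : R) : cole_hopf eps phi (h *: delta_mx 0 i + x) lambda =
    - eps * ln (C * (E h * L h)).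
  rewrite /cole_hopf -/C; congr (_ * ln (_ * _)).
  rewrite /L -RintegralZl//; last first.
    exact: (integrable_gibbs_laplace m0 e0 scV lscV pmin).
  by apply: eq_Rintegral => t _; rewrite cole_hopf_integrand_shift.
have dE : is_derive (0 : R) (1 : R) E 0.
  have d1 : is_derive (0 : R) (1 : R)
      (fun h : R => - h ^+ 2 / (2 * eps * lambda)) 0.
    by apply: is_derive_eq; rewrite /GRing.scale/=; ring.
  have := @is_derive1_comp R expR _ 0 _ _ (is_derive_expR _) d1.
  by rewrite mulr0.
have dg : is_derive (0 : R) (1 : R) (fun h : R => - eps * ln (C * (E h * L h)))
    (- eps * (k * A / Z)).
  have d2 : is_derive (0 : R) (1 : R) (fun h : R => C * (E h * L h))
      (C * (k * A)).
    apply: is_derive_eq; rewrite /GRing.scale/= /E expr0n/= oppr0 mul0r expR0.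
    by ring.
  have E0 : E 0 = 1 by rewrite /E expr0n/= oppr0 mul0r expR0.
  have pos : 0 < C * (E 0 * L 0) by rewrite E0 L0 mul1r mulr_gt0.
  have d3 := @is_derive1_comp R (@ln R) _ 0 _ _ (is_derive1_ln pos) d2.
  apply: is_derive_eq; rewrite /GRing.scale/= E0 L0.
  by field; rewrite !gt_eqF.
have -> : typef_approx eps lambda phi x 0 i = x 0 i - lambda *
    'D_(delta_mx 0 i) (fun z => cole_hopf eps phi z lambda) x.
  by rewrite !mxE.
pose g (h : R) := - eps * ln (C * (E h * L h)).
have -> : 'D_(delta_mx 0 i) (fun z => cole_hopf eps phi z lambda) x =
    'D_1 g (0 : R).
  pose quot (h : R) := h^-1 *: (cole_hopf eps phi (h *: delta_mx 0 i + x) lambda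
    - cole_hopf eps phi x lambda).
  have quotE : quot = (fun h : R => h^-1 *: (g (h *: 1 + 0) - g 0)).
    apply/funext => h; rewrite /quot lineE.
    have := lineE 0; rewrite scale0r add0r => ->.
    by rewrite [h *: 1]mulr1 addr0.
  by rewrite /derive -[LHS]/(lim (quot h @[h --> 0^'])) quotE.
rewrite (@derive_val _ _ _ _ _ _ _ dg) /k.
by field; rewrite !gt_eqF.
Qed.

Lemma enorm_prox_sub_typef_approx (R : realType) (N : nat)
    (m eps lambda : R) (phi : 'rV[R]_N -> R) (x p : 'rV[R]_N) :
  let V := prox_objective lambda phi x in
  0 < m -> 0 < eps -> 0 < lambda -> strongly_convex m V ->
  (forall a, open [set z | a < V z]) -> (forall z, V p <= V z) ->
  enorm (p - typef_approx eps lambda phi x) <= Num.sqrt (N%:R * m^-1 * eps).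
Proof.
move=> V m0 e0 l0 scV lscV pmin.
have Z0 := gibbs_partition_gt0 m0 e0 scV lscV pmin.
have sm := gibbs_second_moment m0 e0 scV lscV pmin.
have gm := gibbs_mean_sqr m0 e0 scV lscV pmin.
have gs := gibbs_coord_shift m0 e0 scV lscV pmin.
set Z := Rintegral _ _ (gibbs eps V) in Z0 sm gm gs.
rewrite /enorm ler_wsqrtr//.
apply: (@le_trans _ _ (\sum_(i < N) (\int[lebesgue_tuple R N]_t
    (gibbs eps V t * (tnth t i - p 0 i) ^+ 2)) / Z)).
  apply: ler_sum => i _; apply: le_trans (gm (p 0 i) i).
  rewrite le_eqVlt; apply/orP; left; apply/eqP.
  have -> : (p - typef_approx eps lambda phi x) 0 i =
      p 0 i - typef_approx eps lambda phi x 0 i by rewrite !mxE.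
  rewrite (typef_approxE i m0 e0 l0 scV lscV pmin).
  rewrite (gs (x 0 i) (p 0 i)) -/Z.
  by field; rewrite gt_eqF.
rewrite -mulr_suml ler_pdivrMr// -(ler_pM2l (divr_gt0 m0 e0)).
apply: (le_trans sm); rewrite le_eqVlt; apply/orP; left; apply/eqP.
by field; rewrite !gt_eqF.
Qed.

Theorem proposition21 (R : realType) (N : nat) (phi : 'rV[R]_N -> R)
    (rho lambda eps : R)
    (phi_proper : proper_function (EFin \o phi))
    (phi_lsc : lower_semicontinuous (EFin \o phi))
    (phi_wc : weakly_convex rho phi)
    (lambda_gt0 : 0 < lambda)
    (lambda_rho : 0 < lambda^-1 - rho)
    (eps_gt0 : 0 < eps) :
  (ereal_sup (range (fun x : 'rV[R]_N =>
       (enorm (prox lambda phi x - typef_approx eps lambda phi x))%:E))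
   <= (Num.sqrt (N%:R * (lambda^-1 - rho)^-1 * eps))%:E)%E.
Proof.
apply: ge_ereal_sup => _ [x _ <-]; rewrite lee_fin.
have scV := @strongly_convex_prox_objective R N rho lambda phi x phi_wc.
have lscV a := @open_prox_objective_gt R N lambda phi x a phi_lsc.
have /xgetPex minV := strongly_convex_min lambda_rho scV lscV.
exact: (enorm_prox_sub_typef_approx lambda_rho eps_gt0 lambda_gt0 scV lscV
  (minV 0)).
Qed.
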